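(* The strongly connected synchronizing automata over $\Sigma$ are exactly the homomorphic images of the automata in the class $\mathcal{L}(\Sigma)$ of all trim automata $\mathscr{A}=\langle Q,\Sigma,\delta,q_0,\{q_0\}\rangle$ such that $L[\mathscr{A}]=w^{-1}\Sigma^{*}w$ for some word $w\in\Sigma^{*}$. That is, every homomorphic image of an automaton in $\mathcal{L}(\Sigma)$ is a strongly connected synchronizing automaton, and every strongly connected synchronizing automaton over $\Sigma$ is a homomorphic image of some automaton in $\mathcal{L}(\Sigma)$.
   Context: $\Sigma$ is a finite non-empty alphabet. A DFA $\langle Q,\Sigma,\delta\rangle$ has a finite non-empty state set and a totally defined transition function $\delta:Q\times\Sigma\to Q$, extended to words; it may also carry an initial state $q_0$ and a set $F$ of final states, and then $L[\mathscr{A}]=\{u\in\Sigma^*: \delta(q_0,u)\in F\}$. It is synchronizing if there is a word $u$ with $\delta(q,u)=\delta(q',u)$ for all $q,q'\in Q$. It is strongly connected if for each pair of different states $p,q$ some word maps $p$ to $q$. $w^{-1}\Sigma^*w=\{v\in\Sigma^*: wv\in\Sigma^*w\}$. A DFA with initial state $q_0$ and final set $F$ is trim if each state is reachable from $q_0$ and each state in $F$ is reachable from some state. A homomorphism from $\langle Q,\Sigma,\delta\rangle$ to $\langle T,\Sigma,\xi\rangle$ is a map $\varphi:Q\to T$ with $\varphi(\delta(q,a))=\xi(\varphi(q),a)$ for all $q\in Q$, $a\in\Sigma$ (initial and final states are ignored); the subautomaton on $\varphi(Q)$ is called a homomorphic image of $\langle Q,\Sigma,\delta\rangle$. *)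

(* Defs.v *)
From mathcomp Require Import all_boot.

Set Implicit Arguments.
Unset Strict Implicit.
Unset Printing Implicit Defensive.

Section Automata.
Variable Sigma : finType.

Record dfa := DFA {
  state :> finType;
  state_gt0 : 0 < #|state|;
  trans : state -> Sigma -> state }.

Definition run (A : dfa) (q : A) (u : seq Sigma) : A := foldl (@trans A) q u.

Definition reachable (A : dfa) (p q : A) : Prop := exists u, run p u = q.

Definition synchronizing (A : dfa) : Prop :=
  exists u, forall q q' : A, run q u = run q' u.

Definition strongly_connected (A : dfa) : Prop :=
  forall p q : A, p <> q -> reachable p q.

Record acceptor := Acceptor {
  base :> dfa;
  init : base;
  final : {set base} }.

Definition lang (A : acceptor) : pred (seq Sigma) :=
  [pred u | run (init A) u \in final A].

(* The second condition is always met (take the empty word).  The usual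
   co-accessibility condition, that every state leads to some final state, is
   automatic for the automata of [class_L] below: if [lang A] is
   [w^-1 Sigma^* w], then [w] leads from every state reachable from [init A]
   into [final A], since [w ++ u ++ w] ends with [w] for every [u]. *)
Definition trim (A : acceptor) : Prop :=
  (forall q : A, reachable (init A) q) /\
  (forall q : A, q \in final A -> exists p : A, reachable p q).

(* Sigma^* w *)
Definition principal_left_ideal (w : seq Sigma) : pred (seq Sigma) :=
  [pred v | suffix w v].

(* w^-1 L *)
Definition left_quotient (w : seq Sigma) (L : pred (seq Sigma)) :
  pred (seq Sigma) := [pred v | w ++ v \in L].

Definition class_L (A : acceptor) : Prop :=
  [/\ final A = [set init A],
      trim A &
      exists w, lang A =i left_quotient w (principal_left_ideal w)].

Definition homomorphism (A T : dfa) (phi : A -> T) : Prop :=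
  forall (q : A) (a : Sigma), phi (trans q a) = trans (phi q) a.

Definition isomorphic (A B : dfa) : Prop :=
  exists2 f : A -> B, homomorphism f & bijective f.

Section Subautomaton.
Variables (T : dfa) (P : {set T}).
Hypothesis P_gt0 : 0 < #|P|.
Hypothesis P_closed : forall (t : T) (a : Sigma), t \in P -> trans t a \in P.

Let sub_state : finType := {t : T | t \in P}.

Lemma sub_state_gt0 : 0 < #|sub_state|.
Proof. by rewrite card_sig. Qed.

Definition subautomaton : dfa :=
  DFA sub_state_gt0 (fun (t : sub_state) (a : Sigma) =>
    exist (fun x : T => x \in P) (trans (val t) a) (P_closed a (valP t))).
End Subautomaton.

Section Image.
Variables (A T : dfa) (phi : A -> T).

Definition image_states : {set T} := [set phi q | q in A].

Lemma image_states_gt0 : 0 < #|image_states|.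
Proof.
by have /card_gt0P[q _] := state_gt0 A; apply/card_gt0P; exists (phi q); apply: imset_f.
Qed.

Lemma image_states_closed : homomorphism phi ->
  forall (t : T) (a : Sigma), t \in image_states -> trans t a \in image_states.
Proof. by move=> hom _ a /imsetP[q _ ->]; rewrite -hom imset_f. Qed.

Definition image_dfa (hom : homomorphism phi) : dfa :=
  subautomaton image_states_gt0 (image_states_closed hom).
End Image.

(* State sets are types here, so "being" the subautomaton on [phi(A)] is read
   up to isomorphism. *)
Definition homomorphic_image (A B : dfa) : Prop :=
  exists (T : dfa) (phi : A -> T) (hom : homomorphism phi),
    isomorphic (image_dfa hom) B.

End Automata.

(* Main.v *)
Require Import Defs.
From mathcomp Require Import all_boot.

(** If [L[A] = w^-1 Sigma^* w] then [w] resets every state [q = q0 u] to [q0],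
    because [w ++ u ++ w] ends with [w]; with trimness this gives the first half,
    and both properties pass to surjective images.  Conversely, let [w] reset the
    strongly connected automaton [B] to [b0].  Run [B] from [b0] in parallel with
    a window, initially [w], that remembers the last [|w|] letters read, and keep
    the reachable states.  A word [v] loops at the initial state iff [w ++ v]
    ends with [w]: the window requires it, and then [b0 v = b0 (w v) = b0]. *)

Set Implicit Arguments.
Unset Strict Implicit.
Unset Printing Implicit Defensive.

Section HomomorphicImages.
Variable Sigma : finType.
Implicit Types A B T : dfa Sigma.

Lemma run_cat A (q : A) u v : run q (u ++ v) = run (run q u) v.
Proof. exact: foldl_cat. Qed.

Lemma run_hom A T (phi : A -> T) (q : A) u :
  homomorphism phi -> phi (run q u) = run (phi q) u.
Proof. by move=> hom; elim: u q => //= a u IH q; rewrite IH hom. Qed.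

Lemma val_subautomaton_hom T (P : {set T}) (P0 : 0 < #|P|)
    (Pc : forall (t : T) (a : Sigma), t \in P -> trans t a \in P) :
  homomorphism (fun t : subautomaton P0 Pc => val t).
Proof. by []. Qed.

(** Corestricting [phi] to its image and composing with the isomorphism gives a surjection;
    conversely a surjective [phi] has all of [B] as image. Surjections spare all later arguments the
    subset types. *)
Lemma homomorphic_imageP A B :
  homomorphic_image A B <->
  exists2 phi : A -> B, homomorphism phi & forall b, exists q, phi q = b.
Proof.
split=> [[T [phi [hom [f fhom [g fK gK]]]]] | [phi hom surj]].
  pose psi (q : A) : image_dfa hom :=
    exist (fun x => x \in image_states phi) (phi q) (imset_f phi (erefl true)).
  exists (f \o psi) => [q a | b] /=.
    by rewrite -fhom; congr f; apply: val_inj; apply: hom.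
  have /imsetP[q _ def_q] := valP (g b).
  exists q; rewrite -[RHS]gK; congr f; exact: val_inj.
have phiP b : b \in image_states phi.
  by have [q <-] := surj b; apply: imset_f.
exists B, phi, hom; exists (fun t : image_dfa hom => val t).
  exact: val_subautomaton_hom.
exists (fun b => exist (fun x => x \in image_states phi) b (phiP b)) => //.
by move=> t; apply: val_inj.
Qed.

Lemma strongly_connected_image A B :
  homomorphic_image A B -> strongly_connected A -> strongly_connected B.
Proof.
move=> /homomorphic_imageP[phi hom surj] scA b b' neq.
have [[p def_b] [q def_b']] := (surj b, surj b').
have [|u def_q] := scA p q; first by move=> eq_pq; apply: neq; rewrite -def_b eq_pq.
by exists u; rewrite -def_b -run_hom // def_q.
Qed.

Lemma synchronizing_image A B :
  homomorphic_image A B -> synchronizing A -> synchronizing B.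
Proof.
move=> /homomorphic_imageP[phi hom surj] [u sync]; exists u => b b'.
have [[p <-] [q <-]] := (surj b, surj b').
by rewrite -!run_hom // (sync p q).
Qed.

End HomomorphicImages.

Section ClassL.
Variables (Sigma : finType) (A : acceptor Sigma).
Hypothesis A_L : class_L A.

Lemma class_L_reset : exists w, forall q : A, run q w = init A.
Proof.
case: A_L => finA [reachA _] [w langA]; exists w => q; have [u <-] := reachA q.
have: u ++ w \in lang A by rewrite langA !inE catA suffix_suffix.
by rewrite inE finA inE run_cat => /eqP.
Qed.

Lemma class_L_synchronizing : synchronizing A.
Proof. by have [w reset] := class_L_reset; exists w => q q'; rewrite !reset. Qed.

(** From any [p], reset to the initial state by [w], then follow a word leading from there to
    [q]. *)
Lemma class_L_strongly_connected : strongly_connected A.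
Proof.
have [w reset] := class_L_reset; case: A_L => _ [reachA _] _ p q _.
by have [u def_q] := reachA q; exists (w ++ u); rewrite run_cat reset.
Qed.

End ClassL.

Section ReachablePart.
Variables (Sigma : finType) (T : dfa Sigma) (t0 : T).

(** A boolean edge relation lets [connect] decide reachability, so that the reachable states form a
    [{set T}]. *)
Definition step : rel T := [rel x y | [exists a, y == trans x a]].

Definition reachable_states : {set T} := [set t | connect step t0 t].

Lemma reachable_states_gt0 : 0 < #|reachable_states|.
Proof. by apply/card_gt0P; exists t0; rewrite inE connect0. Qed.

Lemma reachable_states_closed t a :
  t \in reachable_states -> trans t a \in reachable_states.
Proof.
rewrite !inE => /connect_trans; apply; apply: connect1.
by apply/existsP; exists a.
Qed.

Lemma reachable_statesP t : t \in reachable_states -> reachable t0 t.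
Proof.
rewrite inE => /connectP[p]; elim: p t0 => [|y p IH] x /=.
  by move=> _ ->; exists [::].
case/andP=> /existsP[a /eqP ->] /IH IHp /IHp[u def_t].
by exists (a :: u).
Qed.

Definition reachable_acceptor : acceptor Sigma :=
  let A := subautomaton reachable_states_gt0 reachable_states_closed in
  let q0 : A := exist (fun t => t \in reachable_states) t0
    (etrans (in_set _ _) (connect0 _ _)) in
  Acceptor q0 [set q0].

Lemma val_run_reachable u : val (run (init reachable_acceptor) u) = run t0 u.
Proof. exact: (run_hom _ _ (@val_subautomaton_hom _ _ _ _ _)). Qed.

Lemma reachable_acceptor_trim : trim reachable_acceptor.
Proof.
split=> q; last by exists q, [::].
have [u def_q] := reachable_statesP (valP q).
by exists u; apply: val_inj; rewrite val_run_reachable.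
Qed.

Lemma reachable_acceptor_lang u :
  (u \in lang reachable_acceptor) = (run t0 u == t0).
Proof. by rewrite !inE -val_eqE val_run_reachable. Qed.

End ReachablePart.

Section Window.
Variables (Sigma : finType) (B : dfa Sigma) (n : nat).

(** Appending before dropping the oldest letter keeps the length [n] even when [n = 0]. *)
Definition shift (t : n.-tuple Sigma) a : n.-tuple Sigma :=
  [tuple of behead (rcons t a)].

Definition window_state : finType := (n.-tuple Sigma * B)%type.

Lemma window_state_gt0 (t : n.-tuple Sigma) : 0 < #|window_state|.
Proof.
by have /card_gt0P[b _] := state_gt0 B; apply/card_gt0P; exists (t, b).
Qed.

(** The argument [t] witnesses that the state set is non-empty. *)
Definition window_dfa (t : n.-tuple Sigma) : dfa Sigma :=
  DFA (window_state_gt0 t) (fun x a => (shift x.1 a, trans x.2 a)).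

Lemma run_window (t0 : n.-tuple Sigma) (x : window_dfa t0) v :
  val (run x v).1 = drop (size v) (x.1 ++ v) /\ (run x v).2 = run x.2 v.
Proof.
elim: v x => [|a v IH] [t b] /=; first by rewrite drop0 cats0.
have [-> ->] := IH (shift t a, trans b a); split=> //=.
rewrite -cat_rcons -addn1 -drop_drop drop1.
(* Since [rcons t a] is non-empty, [behead] commutes with appending [v]. *)
by case: (rcons t a) (size_rcons t a).
Qed.

End Window.

Lemma class_L_cover (Sigma : finType) (B : dfa Sigma) :
  strongly_connected B -> synchronizing B ->
  exists A : acceptor Sigma, class_L A /\ homomorphic_image A B.
Proof.
move=> scB [w sync]; have /card_gt0P[b _] := state_gt0 B.
pose b0 := run b w.
have reset q : run q w = b0 by apply: sync.
pose x0 : window_dfa B (in_tuple w) := (in_tuple w, b0).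
exists (reachable_acceptor x0); split.
  split=> //; first exact: reachable_acceptor_trim.
  (* The suffix test becomes [drop (size v) (w ++ v) == w], which is the window after reading
     [v]. *)
  exists w => v; rewrite reachable_acceptor_lang !inE suffixE size_cat addKn.
  have [win runB] := run_window x0 v.
  apply/eqP/eqP=> [loop | suff_w]; first by rewrite -[RHS]/(val x0.1) -loop win.
  rewrite [LHS]surjective_pairing runB; congr pair.
    by apply: val_inj; rewrite win.
  (* Here [run b0 v = run b (w ++ v)], and [w ++ v] is some prefix followed by the reset word
     [w]. *)
  by rewrite /= /b0 -run_cat -(cat_take_drop (size v) (w ++ v)) suff_w run_cat reset.
apply/homomorphic_imageP.
exists (fun q : reachable_acceptor x0 => (val q).2) => // b'.
(* Strong connectivity only concerns distinct states, so [b' = b0] is treated apart. *)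
have [<-|/eqP neq] := eqVneq b0 b'; first by exists (init _).
have [u <-] := scB _ _ neq; exists (run (init _) u).
by rewrite val_run_reachable; have [_ ->] := run_window x0 u.
Qed.

Theorem corollary1 (Sigma : finType) (Sigma_gt0 : 0 < #|Sigma|) :
  (forall (A : acceptor Sigma) (B : dfa Sigma),
      class_L A -> homomorphic_image A B ->
      strongly_connected B /\ synchronizing B) /\
  (forall B : dfa Sigma,
      strongly_connected B -> synchronizing B ->
      exists A : acceptor Sigma, class_L A /\ homomorphic_image A B).
Proof.
split=> [A B A_L imgB|]; last exact: class_L_cover.
split.
  exact: strongly_connected_image imgB (class_L_strongly_connected A_L).
exact: synchronizing_image imgB (class_L_synchronizing A_L).
Qed.
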